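(* Let $k$ be an algebraically closed field of characteristic $2$, let $G$ be a finite group, and let $B$ be a $2$-block of $G$ (that is, a block of $kG$) such that all $B$-subsections of $G$ are major. Then the defect groups of $B$ are abelian.
   Context: Let $p$ be a prime and $k$ an algebraically closed field of characteristic $p$. For a finite group $G$, a $p$-block of $G$ is an indecomposable direct summand $B$ of the group algebra $kG$ as a $(kG,kG)$-bimodule; equivalently $B=kG\,e_B$ for a primitive idempotent $e_B$ of $Z(kG)$. For a $p$-subgroup $P$ of $G$, the Brauer map $\mathrm{Br}_P: Z(kG)\to Z(kC_G(P))$ is the $k$-algebra homomorphism given by $\sum_{g\in G}\lambda_g g\mapsto \sum_{g\in C_G(P)}\lambda_g g$. The defect groups of $B$ are the $p$-subgroups $D$ of $G$ that are maximal with respect to inclusion subject to $\mathrm{Br}_D(e_B)\neq 0$; they form a single $G$-conjugacy class of subgroups. If $x\in G$ is a $p$-element (an element of order a power of $p$, including $x=1$) and $b$ is a block of $C_G(x)$, the induced block $b^G$ is the unique block $B$ of $G$ such that $\mathrm{Br}_{\langle x\rangle}(e_B)\,e_b\neq 0$ (equivalently, $\mathrm{Br}_{\langle x\rangle}(e_B)\,e_b=e_b$). A $B$-subsection of $G$ is a pair $(x,b)$ where $x$ is a $p$-element of $G$ and $b$ is a block of $C_G(x)$ with $b^G=B$. A $B$-subsection $(x,b)$ is called major if the defect groups of $b$ (as a block of $C_G(x)$) are also defect groups of $B$. In the claim these notions are used with $p=2$. *)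

(* Defs.v *)
From mathcomp Require Export all_boot all_order all_fingroup all_algebra.
From mathcomp Require Export all_solvable all_field all_character.

Set Implicit Arguments.
Unset Strict Implicit.
Unset Printing Implicit Defensive.

Import GroupScope GRing.Theory.
Local Open Scope ring_scope.

Section Blocks.

Variables (k : fieldType) (gT : finGroupType).
Implicit Types (G P D : {group gT}) (p : nat) (x : gT).

(* kG is the library's [group_ring k G]: the algebra of #|G| x #|G| matrices  *)
(* spanned by the matrices [regular_repr k G g], g \in G, of right            *)
(* multiplication by g. For a in kG and g \in G, [gr_coef G a g] is the       *)
(* coefficient of g in a (junk when g \notin G).                              *)
Definition gr_coef G (a : 'M[k]_#|G|) (g : gT) : k :=
  gring_row a 0 (gring_index G g).

(* The map is defined on all matrices, but is meaningful only on kG.          *)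
Definition brauer G P (a : 'M[k]_#|G|) : 'M[k]_#|'C_G(P)| :=
  \sum_(g in 'C_G(P)) gr_coef a g *: regular_repr k 'C_G(P) g.

(* A block kG * e is represented by its block idempotent e, a primitive       *)
(* idempotent of Z(kG).                                                       *)
Definition is_block G (e : 'M[k]_#|G|) : Prop :=
  [/\ (e \in 'Z(group_ring k G))%MS, e *m e = e, e != 0
    & forall f1 f2 : 'M[k]_#|G|,
        (f1 \in 'Z(group_ring k G))%MS -> (f2 \in 'Z(group_ring k G))%MS ->
        f1 *m f1 = f1 -> f2 *m f2 = f2 -> f1 *m f2 = 0 -> e = f1 + f2 ->
        f1 = 0 \/ f2 = 0].

Arguments is_block G%_G e%_R : clear implicits.

Definition defect_group p G (e : 'M[k]_#|G|) D : bool :=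
  [max D | [&& D \subset G, p.-group D & brauer D e != 0]].

Arguments defect_group p%_N G%_G e%_R D%_G : clear implicits.

(* eb is the idempotent of a block b of C_G(x), and e that of a block B of G. *)
(* C_G(x) is written 'C_G(<[x]>) because this is the group through which      *)
(* Br_<x> is defined; it equals 'C_G[x] by [cent_cycle]. The last conjunct    *)
(* says b^G = B, since B is the only block of G with this property.           *)
Definition subsection p G (e : 'M[k]_#|G|) x
    (eb : 'M[k]_#|'C_G(<[x]>)|) : Prop :=
  [/\ x \in G, p.-elt x, is_block 'C_G(<[x]>) eb
    & brauer <[x]> e *m eb != 0].

Definition major p G (e : 'M[k]_#|G|) x (eb : 'M[k]_#|'C_G(<[x]>)|) : Prop :=
  forall D, defect_group p 'C_G(<[x]>) eb D -> defect_group p G e D.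

Lemma gr_coef_sum G (l : gT -> k) g : g \in G ->
  gr_coef (\sum_(h in G) l h *: regular_repr k G h) g = l g.
Proof.
move=> Gg; rewrite /gr_coef linear_sum summxE (bigD1 g) //= big1 ?addr0.
  rewrite linearZ /= mxE /gring_row rowK gring_indexK // mul1g.
  by rewrite mxE !eqxx mulr1.
move=> h /andP[Gh ne_hg]; rewrite linearZ /= mxE /gring_row rowK.
rewrite gring_indexK // mul1g mxE eqxx /=.
case: eqP => [/(congr1 enum_val)|_]; last by rewrite mulr0.
by rewrite !gring_indexK // => eq_gh; rewrite eq_gh eqxx in ne_hg.
Qed.

Lemma brauer_sum G P (l : gT -> k) :
  brauer P (\sum_(g in G) l g *: regular_repr k G g) =
  \sum_(g in 'C_G(P)) l g *: regular_repr k 'C_G(P) g.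
Proof. by apply: eq_bigr => g /setIP[Gg _]; rewrite gr_coef_sum. Qed.

End Blocks.

Arguments is_block {k gT} G%_G e%_R.
Arguments defect_group {k gT} p%_N G%_G e%_R D%_G.
Arguments subsection {k gT} p%_N G%_G e%_R x%_g eb%_R.
Arguments major {k gT} p%_N G%_G e%_R x%_g eb%_R.

(* Main.v *)
From HB Require Import structures.
From Stdlib Require Import Classical_Prop.
Require Import Defs.

Set Implicit Arguments.
Unset Strict Implicit.
Unset Printing Implicit Defensive.

Import GroupScope GRing.Theory.
Local Open Scope ring_scope.

(** Let B be the block with idempotent e, and let D be a defect group of B. The
    proof first shows that D behaves as in a group where every 2-element is
    conjugate into the center of a Sylow subgroup, and then concludes by
    elementary manipulations with square roots.

    - Two involutions a, b of D commute [involutions_commute]. The product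
      x = ab is inverted by a. If a did not centralize x, then a would permute
      the blocks f of C_G(x) with (x, f) a B-subsection. In characteristic 2,
      the sum of an orbit of length 2 is killed by Br_D, as a lies in D. Since
      Br_D(e) is not zero, some f is fixed by a [stable_block_below]. As (x, f)
      is major, the defect groups of f have order |D|. But f is also a central
      idempotent for the group C_G(x)<a>, where its defect is larger by the
      index of C_G(x) [defect_class]. This produces a 2-subgroup S of G with
      Br_S(e) <> 0 and |S| > |D|, which is absurd.
    - If t lies in D and u = t^2 in Z(D), then u has a square root in Z(D)
      [square_root_in_center]. Choose a block b of C_G(u) below Br_u(e) having
      D as a defect group, and a block f of C_G(t) below Br_t(b). As (t, f) is
      major, a defect group R of f is one of B, hence also one of b, and t lies
      in Z(R). Now R and D are conjugate in C_G(u), and the conjugation moves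
      t into Z(D) and fixes u.
    - Involutions v of D are central in D [involution_central]. By induction
      on the order of t in D, u = t^2 commutes with v. Majority of a subsection
      (u, b) gives another defect group R of B which contains C_D(u), hence t
      and v, and in which u is central. There u = z^2 with z in Z(R), and
      t z^-1 has square 1, so that it commutes with v; hence so does t.
    - Finally every t in D is central, by induction on its order: t^2 = z^2
      with z in Z(D), and t z^-1 is central because its square is 1.

    The block theory needed is built on central characters. If f is a block
    idempotent of H and z is central in kH, then z f has a single eigenvalue
    [central_eigenvalue]. Expanding f = f^2 in class sums yields a class on
    which f does not vanish and whose class sum has a nonzero eigenvalue; the
    Sylow subgroups of the centralizers of its elements are the defect groups
    [defect_contains_conj].

    All group algebras kH live in one algebra of functions on the ambient
    group, where Br_P is the restriction of functions to C(P). This makes the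
    Brauer maps of all subgroups compatible on the nose. *)

(** * The group algebra of the ambient group *)

(** An alias of the type of functions, on which multiplication is the
    convolution and not the pointwise product. *)
Definition galg (k : fieldType) (gT : finGroupType) := {ffun gT -> k^o}.

HB.instance Definition _ k gT := GRing.Lmodule.on (galg k gT).

Section GroupAlgebra.

Variables (k : fieldType) (gT : finGroupType).
Local Notation A := (galg k gT).
Implicit Types (a b c f z : A) (g h x y : gT) (H M P Q R : {group gT}).

Definition gdelta x : A := [ffun g => (g == x)%:R].

Definition gmul a b : A := [ffun g => \sum_h (a h * b (h^-1 * g)%g : k)].

Lemma gmulA : associative gmul.
Proof.
move=> a b c; apply/ffunP=> g; rewrite !ffunE.
under eq_bigr => h _ do rewrite ffunE mulr_sumr.
under [RHS]eq_bigr => h _ do rewrite ffunE mulr_suml.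
rewrite [RHS]exchange_big /=; apply: eq_bigr => x _.
rewrite [RHS](reindex_inj (mulgI x)) /=; apply: eq_bigr => h _.
by rewrite mulKg invMg !mulgA mulrA.
Qed.

Lemma gmul1l : left_id (gdelta 1) gmul.
Proof.
move=> a; apply/ffunP=> g; rewrite !ffunE (bigD1 1%g) //= big1 => [|h].
  by rewrite ffunE eqxx invg1 mul1g mul1r addr0.
by move=> /negPf h1; rewrite ffunE h1 mul0r.
Qed.

Lemma gmul1r : right_id (gdelta 1) gmul.
Proof.
move=> a; apply/ffunP=> g; rewrite !ffunE (bigD1 g) //= big1 => [|h].
  by rewrite ffunE mulVg eqxx mulr1 addr0.
by move=> /negPf hg; rewrite ffunE -eq_mulVg1 hg mulr0.
Qed.

Lemma gmulDl : left_distributive gmul +%R.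
Proof.
move=> a b c; apply/ffunP=> g; rewrite !ffunE -big_split /=.
by apply: eq_bigr => h _; rewrite !ffunE mulrDl.
Qed.

Lemma gmulDr : right_distributive gmul +%R.
Proof.
move=> a b c; apply/ffunP=> g; rewrite !ffunE -big_split /=.
by apply: eq_bigr => h _; rewrite !ffunE mulrDr.
Qed.

Lemma gdelta1_neq0 : gdelta 1 != 0 :> A.
Proof.
by apply/eqP=> /ffunP/(_ 1%g)/eqP; rewrite !ffunE eqxx oner_eq0.
Qed.

HB.instance Definition _ := GRing.Zmodule_isNzRing.Build (galg k gT)
  gmulA gmul1l gmul1r gmulDl gmulDr gdelta1_neq0.

Lemma gscaleAl (u : k) a b : u *: (a * b) = (u *: a) * b.
Proof.
apply/ffunP=> g; rewrite !ffunE scaler_sumr.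
by apply: eq_bigr => h _; rewrite !ffunE scalerAl.
Qed.

HB.instance Definition _ := GRing.Lmodule_isLalgebra.Build k (galg k gT)
  gscaleAl.

Lemma gscaleAr (u : k) a b : u *: (a * b) = a * (u *: b).
Proof.
apply/ffunP=> g; rewrite !ffunE scaler_sumr.
by apply: eq_bigr => h _; rewrite !ffunE scalerAr.
Qed.

HB.instance Definition _ := GRing.Lalgebra_isAlgebra.Build k (galg k gT)
  gscaleAr.

Lemma galgM a b g : (a * b) g = \sum_h (a h * b (h^-1 * g)%g : k).
Proof. by rewrite ffunE. Qed.

(** * Centers of subgroup algebras and the Brauer homomorphism *)

Definition class_fun (M : {set gT}) a :=
  forall g h, g \in M -> a (h ^ g)%g = a h.

(** The subalgebra kH is the set of functions supported in H. *)
Definition supported (H : {set gT}) a := forall h, h \notin H -> a h = 0.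

Definition in_center (H : {set gT}) a := supported H a /\ class_fun H a.

(** The Brauer map Br_P, with values in k[C_H(P)], is [trunc 'C(P)] on kH,
    whatever H is. *)
Definition trunc (S : {set gT}) a : A := [ffun g => if g \in S then a g else 0].

Lemma truncD (S : {set gT}) a b : trunc S (a + b) = trunc S a + trunc S b.
Proof. by apply/ffunP=> g; rewrite !ffunE; case: ifP; rewrite ?addr0. Qed.

Lemma trunc0 (S : {set gT}) : trunc S (0 : A) = 0.
Proof. by apply/ffunP=> h; rewrite !ffunE if_same. Qed.

Lemma trunc_trunc (S T : {set gT}) a : S \subset T ->
  trunc S (trunc T a) = trunc S a.
Proof.
move=> sST; apply/ffunP=> g; rewrite !ffunE.
by case: ifP => // gS; rewrite (subsetP sST).
Qed.

Lemma class_funM (M : {set gT}) a b :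
  class_fun M a -> class_fun M b -> class_fun M (a * b).
Proof.
move=> Ma Mb g h gM; rewrite !galgM (reindex_inj (conjg_inj g)) /=.
by apply: eq_bigr => x _; rewrite -conjVg -conjMg Ma ?Mb.
Qed.

Lemma supportedM (H : {group gT}) a b : supported H a -> supported H b ->
  supported H (a * b).
Proof.
move=> Ha Hb h nhH; rewrite galgM big1 // => x _.
have [xH | nxH] := boolP (x \in H); last by rewrite Ha ?mul0r.
by rewrite Hb ?mulr0 // groupMl ?groupV.
Qed.

Lemma class_fun_comm (M : {set gT}) a b : class_fun M a -> supported M b ->
  a * b = b * a.
Proof.
move=> Ma Mb; apply/ffunP=> g; rewrite !galgM.
rewrite (reindex_inj (inj_comp (mulgI g) (@invg_inj _))) /=.
apply: eq_bigr => x _; rewrite invMg invgK mulgKV mulrC.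
have [xM | nxM] := boolP (x \in M); last by rewrite Mb ?mul0r.
by rewrite -(Ma x) // /conjg mulgKV.
Qed.

(** The coefficient at g in C(P) of a product is a sum over the ambient group
    which is constant on the orbits of P. The orbits that are not singletons
    have length divisible by p, so only the terms indexed by C(P) remain. *)
Lemma trunc_mul (p : nat) P a b : p \in [pchar k] -> p.-group P ->
    class_fun P a -> class_fun P b ->
  trunc 'C(P) (a * b) = trunc 'C(P) a * trunc 'C(P) b.
Proof.
move=> chp pP Pa Pb; apply/ffunP=> g; rewrite [LHS]ffunE !galgM.
have [gC | ngC] := boolP (g \in 'C(P)); last first.
  rewrite big1 // => x _; rewrite !ffunE.
  have [xC | nxC] := boolP (x \in _); last by rewrite mul0r.
  by rewrite groupMl ?groupV // (negPf ngC) mulr0.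
rewrite (bigID (mem 'C(P))) /= [X in _ + X = _](_ : _ = 0); last first.
  have part : partition (orbit 'J%act P @: ~: 'C(P)) (~: 'C(P)).
    by apply: orbit_partition; rewrite astabsJ normCs norms_cent ?normG.
  under eq_bigl => x do rewrite -in_setC.
  rewrite (set_partition_big _ part) big1 //= => _ /imsetP[x nxC ->].
  rewrite (eq_bigr (fun _ => a x * b (x^-1 * g)%g : k)); last first.
    move=> _ /orbitP[y yP <-].
    have gy : (g ^ y = g)%g by apply/conjg_fixP/commgP; apply: (centP gC).
    by rewrite /= !Pa // -[in RHS](Pb y) // conjMg conjVg gy.
  rewrite sumr_const -mulr_natr (_ : _%:R = 0) ?mulr0 //; apply/eqP.
  rewrite -(dvdn_pcharf chp) //.
  have pO : p.-nat #|orbit 'J P x| by apply: pnat_dvd pP; apply: dvdn_orbit.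
  have [[|n] Dn] := p_natP pO; last by rewrite Dn dvdn_exp.
  case/setCP: nxC; apply/centP=> y yP; apply/commgP/conjg_fixP/set1P.
  by rewrite -(card_orbit1 Dn) mem_orbit.
rewrite addr0 [RHS](bigID (mem 'C(P))) /= [X in _ = _ + X]big1 ?addr0.
  by apply: eq_bigr => x xC; rewrite !ffunE xC groupMl ?groupV ?gC.
by move=> x; rewrite ffunE => /negPf->; rewrite mul0r.
Qed.

Lemma in_centerD (H : {set gT}) a b : in_center H a -> in_center H b ->
  in_center H (a + b).
Proof.
move=> [sa ca] [sb cb]; split=> [h nh|g h gH].
  by rewrite ffunE sa ?sb ?addr0.
by rewrite !ffunE ca ?cb.
Qed.

Lemma in_centerZ (H : {set gT}) (u : k) a : in_center H a ->
  in_center H (u *: a).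
Proof.
move=> [sa ca]; split=> [h nh|g h gH]; first by rewrite ffunE sa ?scaler0.
by rewrite !ffunE ca.
Qed.

Lemma in_centerN (H : {set gT}) a : in_center H a -> in_center H (- a).
Proof. by rewrite -scaleN1r; apply: in_centerZ. Qed.

Lemma in_centerB (H : {set gT}) a b : in_center H a -> in_center H b ->
  in_center H (a - b).
Proof. by move=> Ha /in_centerN; apply: in_centerD. Qed.

Lemma in_center0 (H : {set gT}) : in_center H 0.
Proof. by split=> [h|g h]; rewrite !ffunE. Qed.

Lemma in_center1 H : in_center H 1.
Proof.
split=> [h nh|g h gH]; rewrite !ffunE; last by rewrite conjg_eq1.
by case: eqP nh => // ->; rewrite group1.
Qed.

Lemma in_centerM H a b : in_center H a -> in_center H b -> in_center H (a * b).
Proof.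
by move=> [sa ca] [sb cb]; split; [apply: supportedM | apply: class_funM].
Qed.

Lemma in_centerC (H : {set gT}) a b : in_center H a -> in_center H b ->
  a * b = b * a.
Proof. by move=> [_ ca] [sb _]; apply: class_fun_comm ca sb. Qed.

Lemma in_center_horner H z (p : {poly k}) : in_center H z ->
  in_center H (horner_alg z p).
Proof.
move=> Hz; elim/poly_ind: p => [|p u IHp].
  by rewrite rmorph0; apply: in_center0.
rewrite rmorphD rmorphM /= horner_algX horner_algC.
by apply: in_centerD; [apply: in_centerM | apply/in_centerZ/in_center1].
Qed.

(** * Blocks and central characters *)

(** The algebra has finite dimension N, so N + 1 powers of an element are
    linearly dependent. *)
Lemma horner_alg_annihilator a :
  exists2 p : {poly k}, p != 0 & horner_alg a p = 0.
Proof.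
pose N := #|gT|.
pose T := \matrix_(i < N.+1, j < N) ((a ^+ i) (enum_val j) : k).
have kerT : kermx T != 0.
  by rewrite kermx_eq0 /row_free neq_ltn ltnS rank_leq_col.
pose v := nz_row (kermx T).
have vT : v *m T = 0 by apply/sub_kermxP; apply: nz_row_sub.
have /rV0Pn[i0 nz_vi] : v != 0 by rewrite nz_row_eq0.
exists (\poly_(i < N.+1) v 0 (inord i)).
  apply: contraNneq nz_vi => /(congr1 (fun p : {poly k} => p`_i0)).
  by rewrite coef_poly ltn_ord inord_val coef0 => ->.
rewrite poly_def linear_sum /=; apply/ffunP=> g.
have := congr1 (fun B : 'rV_N => B 0 (enum_rank g)) vT.
rewrite mxE [RHS]mxE => Eg.
rewrite sum_ffunE ffunE -[RHS]Eg; apply: eq_bigr => i _.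
rewrite linearZ /= mulr_algl rmorphXn /= horner_algX.
by rewrite mxE enum_rankK inord_val ffunE.
Qed.

Definition nilpotent_elt a := exists n, a ^+ n = 0.

Lemma nilpotent_eltD a b : a * b = b * a -> nilpotent_elt a ->
  nilpotent_elt b -> nilpotent_elt (a + b).
Proof.
move=> cab [m am] [n bn]; exists (m + n)%N; rewrite exprDn_comm //.
apply: big1 => i _; have [lt_in | le_ni] := ltnP i n.
  by rewrite -addnBA ?(ltnW lt_in) // exprD am !mul0r mul0rn.
by rewrite -(subnK le_ni) exprD bn !mulr0 mul0rn.
Qed.

Lemma nilpotent_eltZ (u : k) a : nilpotent_elt a -> nilpotent_elt (u *: a).
Proof. by case=> m am; exists m; rewrite exprZn am scaler0. Qed.

Lemma trunc_nilpotent (p : nat) P a : p \in [pchar k] -> p.-group P ->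
  class_fun P a -> nilpotent_elt a -> nilpotent_elt (trunc 'C(P) a).
Proof.
move=> chp pP Pa [n an0]; exists n.
rewrite -[RHS](_ : trunc 'C(P) (a ^+ n) = 0); last by rewrite an0 trunc0.
elim: n {an0} => [|n IHn].
  apply/ffunP=> h; rewrite expr0 !ffunE.
  by case: eqP => [->|_]; rewrite ?group1 // if_same.
rewrite !exprS IHn (trunc_mul chp pP) //.
elim: n {IHn} => [|n IHn]; first by case: (in_center1 P).
by rewrite exprS; apply: class_funM.
Qed.

Lemma idem_nilpotent f : f * f = f -> nilpotent_elt f -> f = 0.
Proof.
move=> ff [[|n] fn]; first by rewrite -[f]mulr1 -(expr0 f) fn mulr0.
suff <-: f ^+ n.+1 = f by [].
by elim: n {fn} => // n IHn; rewrite exprS IHn.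
Qed.

(** The idempotents of blocks: these are the primitive idempotents of Z(kH). *)
Definition block_idem (H : {set gT}) f := [/\ in_center H f, f * f = f, f != 0
  & forall f1 f2, in_center H f1 -> in_center H f2 -> f1 * f1 = f1 ->
      f2 * f2 = f2 -> f1 * f2 = 0 -> f = f1 + f2 -> f1 = 0 \/ f2 = 0].

(** The Bezout relation splits f into two orthogonal central idempotents; one
    of them is zero by primitivity. *)
Lemma block_horner_coprime H f z (p q : {poly k}) :
    block_idem H f -> in_center H z -> coprimep p q ->
    horner_alg z (p * q) * f = 0 ->
  horner_alg z p * f = 0 \/ horner_alg z q * f = 0.
Proof.
move=> [Hf ff _ prim] Hz /Bezout_eq1_coprimepP[[u v] /= uv1] pqf0.
have evC r : f * horner_alg z r = horner_alg z r * f.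
  exact: in_centerC Hf (in_center_horner _ Hz).
have evM r s : horner_alg z r * f * (horner_alg z s * f) =
    horner_alg z (r * s) * f.
  by rewrite -mulrA [f * _]mulrA evC -mulrA ff mulrA -rmorphM.
have Hev r : in_center H (horner_alg z r * f).
  by apply: in_centerM (in_center_horner _ Hz) Hf.
have f12 : f = horner_alg z (u * p) * f + horner_alg z (v * q) * f.
  by rewrite -mulrDl -rmorphD uv1 rmorph1 mul1r.
have f1f2 : horner_alg z (u * p) * f * (horner_alg z (v * q) * f) = 0.
  by rewrite evM mulrACA rmorphM /= -mulrA pqf0 mulr0.
have f2f1 : horner_alg z (v * q) * f * (horner_alg z (u * p) * f) = 0.
  by rewrite -[RHS]f1f2 !evM mulrC.
have fev r : f * (horner_alg z r * f) = horner_alg z r * f.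
  by rewrite mulrA evC -mulrA ff.
have idem1 := fev (u * p); have idem2 := fev (v * q).
rewrite {1}f12 mulrDl f2f1 addr0 in idem1.
rewrite {1}f12 mulrDl f1f2 add0r in idem2.
have absorb s r : horner_alg z r * f = 0 -> horner_alg z (s * r) * f = 0.
  by rewrite rmorphM /= -mulrA => ->; rewrite mulr0.
have [/(absorb p) E|/(absorb q) E] :=
  prim _ _ (Hev _) (Hev _) idem1 idem2 f1f2 f12.
  left; rewrite -[p]mulr1 -uv1 mulrDr [p * (v * q)]mulrCA rmorphD mulrDl /= E.
  by rewrite (absorb v) ?addr0.
right; rewrite -[q]mulr1 -uv1 mulrDr [q * (u * p)]mulrCA [q * p]mulrC.
by rewrite rmorphD mulrDl /= E (absorb u) ?add0r.
Qed.

(** * Class sums *)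

Definition conj_galg y a : A := [ffun h => a (h ^ y^-1)%g].

Lemma conj_galgB y a b : conj_galg y (a - b) = conj_galg y a - conj_galg y b.
Proof. by apply/ffunP=> h; rewrite !ffunE. Qed.

Lemma conj_galg_id y a : class_fun [set y] a -> conj_galg y a = a.
Proof.
by move=> ya; apply/ffunP=> h; rewrite ffunE -(ya y) ?set11 // conjgKV.
Qed.

Lemma conj_galgM y a b : conj_galg y (a * b) = conj_galg y a * conj_galg y b.
Proof.
apply/ffunP=> g; rewrite [LHS]ffunE !galgM (reindex_inj (conjg_inj y^-1%g)) /=.
by apply: eq_bigr => x _; rewrite !ffunE conjMg conjVg.
Qed.

Lemma conj_galg_scalar y (u : k) : conj_galg y u%:A = u%:A.
Proof. by apply/ffunP=> h; rewrite !ffunE conjg_eq1. Qed.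

Lemma conj_galg_nilpotent y a : nilpotent_elt a ->
  nilpotent_elt (conj_galg y a).
Proof.
case=> n an0; exists n; have <- : conj_galg y (a ^+ n) = conj_galg y a ^+ n.
  elim: n {an0} => [|n IHn]; last by rewrite !exprS conj_galgM IHn.
  by rewrite !expr0 -[1]scale1r conj_galg_scalar.
by rewrite an0; apply/ffunP=> h; rewrite !ffunE.
Qed.

Definition gsum (K : {set gT}) : A := [ffun h => (h \in K)%:R].

Lemma conj_gsum y K : conj_galg y (gsum K) = gsum (K :^ y).
Proof. by apply/ffunP=> h; rewrite !ffunE mem_conjg. Qed.

Lemma in_center_gsum (H K : {set gT}) : K \subset H -> H \subset 'N(K) ->
  in_center H (gsum K).
Proof.
move=> sKH nKH; split=> [h nHh | g h gH]; rewrite !ffunE.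
  by rewrite (contraNF (subsetP sKH h) nHh).
by rewrite memJ_norm // (subsetP nKH).
Qed.

Lemma nilpotent_elt_sum (H : {set gT}) (I : Type) (r : seq I)
    (P : pred I) (F : I -> A) :
    (forall i, P i -> in_center H (F i) /\ nilpotent_elt (F i)) ->
  nilpotent_elt (\sum_(i <- r | P i) F i).
Proof.
move=> HF; pose nil_center (x : A) := in_center H x /\ nilpotent_elt x.
suff: nil_center (\sum_(i <- r | P i) F i) by case.
apply: (big_ind nil_center) => //.
  by split; [apply: in_center0 | exists 1%N; rewrite expr1].
move=> a b [Ha na] [Hb nb]; split; first exact: in_centerD.
by apply: nilpotent_eltD na nb; apply: in_centerC Ha Hb.
Qed.

(** The normality of H in M makes the classes of M that meet H lie in H. *)
Lemma class_sum_expansion H M f : H <| M -> supported H f -> class_fun M f ->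
  f = \sum_(L in classes M | L \subset H) f (repr L) *: gsum L.
Proof.
move=> nsHM Hf Mf; have [sHM nHM] := andP nsHM.
apply/ffunP=> h; rewrite sum_ffunE.
have [hH | nhH] := boolP (h \in H); last first.
  rewrite Hf // big1 // => L /andP[_ sLH]; rewrite !ffunE.
  by rewrite (contraNF (subsetP sLH h) nhH) scaler0.
have hM := subsetP sHM h hH.
rewrite (bigD1 (h ^: M)) /=; last by rewrite mem_classes // class_sub_norm.
rewrite big1 => [|_ /andP[/andP[/imsetP[x xM ->] _] ne_xh]].
  have [g gM ->] := repr_class M h.
  by rewrite !ffunE class_refl Mf // [_ *: _]mulr1 addr0.
rewrite !ffunE; case: (boolP (h \in _)) => [/class_eqP E|];
  last by rewrite scaler0.
by rewrite E eqxx in ne_xh.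
Qed.

(** A class of M is a disjoint union of classes of the normal subgroup H,
    which M permutes transitively. *)
Lemma class_sum_split H M g : H <| M ->
  gsum (g ^: M) = \sum_(K in orbit 'Js M (g ^: H)) gsum K.
Proof.
move=> nsHM; have [sHM nHM] := andP nsHM.
apply/ffunP=> h; rewrite sum_ffunE ffunE.
have classJ m : m \in M -> ((g ^: H) :^ m = (g ^ m) ^: H)%g.
  by move=> mM; rewrite -class_rcoset -class_lcoset norm_rlcoset ?(subsetP nHM).
have [/imsetP[m mM ->] | nMh] := boolP (h \in _); last first.
  rewrite big1 // => _ /orbitP[m mM <-]; rewrite ffunE /= classJ //.
  case: imsetP => // -[x xH Dh]; case/negP: nMh; rewrite Dh -conjgM.
  by rewrite memJ_class // groupM // (subsetP sHM).
rewrite (bigD1 ((g ^ m) ^: H)%g) /=; last by rewrite -classJ // mem_orbit.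
rewrite ffunE class_refl big1 ?addr0 // => _ /andP[/orbitP[x xM <-] /=].
rewrite ffunE classJ //; case: (boolP (_ \in _)) => // /class_eqP->.
by rewrite eqxx.
Qed.

End GroupAlgebra.

(** * The class that carries the defect of a block *)

Section Eigen.
Variables (k : closedFieldType) (gT : finGroupType).
Local Notation A := (galg k gT).
Implicit Types (a b c f z : A) (g h x y : gT) (H M P Q R : {group gT}).

(** The scalar u is the value at z of the central character of the block. A
    product of linear factors in z annihilates f; by [block_horner_coprime],
    the factors at a single root already do so. *)
Lemma central_eigenvalue H f z : block_idem H f -> in_center H z ->
  exists u : k, nilpotent_elt ((z - u%:A) * f).
Proof.
move=> prf Hz; have [Hf ff nzf _] := prf.
have [p nz_p pz0] := horner_alg_annihilator z.
have [r Dp] := closed_field_poly_normal p.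
have {p nz_p pz0 Dp}: horner_alg z (\prod_(u <- r) ('X - u%:P)) * f = 0.
  move: pz0; rewrite Dp linearZ /= mulr_algl =>
    /(congr1 ( *:%R (lead_coef p)^-1)).
  by rewrite scaler0 scalerA mulVf ?lead_coef_eq0 // scale1r => ->;
    rewrite mul0r.
have ev u : horner_alg z ('X - u%:P) = z - u%:A.
  by rewrite rmorphB /= horner_algX horner_algC.
have zf u : GRing.comm (z - u%:A) f.
  apply: in_centerC _ Hf; apply: in_centerB Hz _.
  by apply: in_centerZ; apply: in_center1.
have [n le_r_n] := ubnP (size r); elim: n => // n IHn in r le_r_n *.
case: r le_r_n => [_|u r /= lt_r_n].
  by rewrite big_nil rmorph1 mul1r => /eqP/idPn[].
rewrite (bigID (pred1 u)) /= (eq_bigr (fun=> 'X - u%:P)) => [|x /eqP-> //].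
rewrite big_const_seq iter_mulr mulr1; set m := count _ _.
case/(block_horner_coprime prf Hz) => [||].
- apply: coprimep_expl; rewrite coprimep_sym coprimep_XsubC.
  by rewrite -big_filter root_prod_XsubC mem_filter /= eqxx.
- rewrite rmorphXn /= ev => m0; exists u; exists m.+1.
  rewrite exprMn_comm // [_ ^+ m.+1]exprS -mulrA.
  by rewrite [f ^+ _]exprS [_ * (f * _)]mulrA m0 mul0r mulr0.
rewrite -big_filter => /IHn; apply; rewrite /= eqxx /= size_filter.
exact: leq_ltn_trans (count_size _ _) _.
Qed.
End Eigen.

Section Defect.
Variables (k : closedFieldType) (gT : finGroupType).
Local Notation A := (galg k gT).
Implicit Types (a b c f z : A) (g h x y : gT) (H M P Q R : {group gT}).

(** The class sum over M is the sum of its H-class sums. These are conjugate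
    under M, which fixes f, so they have the same eigenvalue u on f. Their
    number is a power of p; if it is not 1, then the sum of the eigenvalues
    vanishes. *)
Lemma class_sum_nilpotent (p : nat) H M f g (u : k) :
    p \in [pchar k] -> H <| M -> p.-group (M / H) ->
    in_center H f -> class_fun M f ->
    nilpotent_elt ((gsum k (g ^: H) - u%:A) * f) -> g \in H ->
  g ^: M = g ^: H \/ nilpotent_elt (gsum k (g ^: M) * f).
Proof.
move=> chp nsHM pMH Hf Mf nu gH; have [sHM nHM] := andP nsHM.
set O := orbit 'Js M (g ^: H).
have sgH : g ^: H \subset H by rewrite class_sub_norm ?normG.
have pO : p.-nat #|O|.
  rewrite card_orbit; apply: pnat_dvd pMH; rewrite card_quotient //.
  apply: indexgS; rewrite subsetI sHM; apply/subsetP=> h hH; apply/astab1P.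
  exact: classGidr.
have [n oO] := p_natP pO; case: n => [|n] in oO.
  left; have:= class_sum_split k g nsHM.
  rewrite (card_orbit1 oO) big_set1 => /ffunP E; apply/setP=> h.
  have /eqP := E h; rewrite !ffunE.
  by do 2!case: (h \in _) => //; rewrite ?(eq_sym 0) oner_eq0.
right; have O0 : #|O|%:R = 0 :> k.
  by apply/eqP; rewrite -(dvdn_pcharf chp) oO dvdn_exp.
have -> : gsum k (g ^: M) * f = \sum_(K in O) (gsum k K - u%:A) * f.
  rewrite -mulr_suml sumrB -class_sum_split // sumr_const -[u%:A *+ _]mulr_natl.
  by rewrite -scaler_nat O0 scale0r mul0r subr0.
apply: (@nilpotent_elt_sum _ _ H) => _ /orbitP[m mM <-] /=.
have mf : conj_galg m f = f.
  by apply: conj_galg_id => x h /set1P Dx; rewrite Mf // Dx.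
split.
  apply: in_centerM Hf; apply: in_centerB; last exact/in_centerZ/in_center1.
  have nHm := subsetP nHM m mM.
  apply: in_center_gsum; first by rewrite -{2}(normP nHm) conjSg.
  by rewrite -{1}(normP nHm) normJ conjSg class_norm.
have := conj_galg_nilpotent m nu.
by rewrite conj_galgM conj_galgB conj_gsum conj_galg_scalar mf.
Qed.

(** Let f be the idempotent of an M-stable block of H, and expand f = f^2 in
    sums over classes of M. As f is not nilpotent, some class sum occurs in f
    and has a nonzero eigenvalue on f. By [class_sum_nilpotent] this class of M
    is a single class of H, so the centralizer of g in M covers M / H: this is
    how the defect of f grows from H to M. The Brauer map of R cannot kill a
    class sum with a nonzero eigenvalue without killing f. *)
Lemma defect_class (p : nat) H M f :
    p \in [pchar k] -> H <| M -> p.-group (M / H) ->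
    block_idem H f -> class_fun M f ->
  exists g, [/\ g \in H, f g != 0, g ^: M = g ^: H
    & forall R, p.-group R -> R \subset H -> trunc 'C(R) f != 0 ->
        exists2 h, h \in g ^: H & h \in 'C(R)].
Proof.
move=> chp nsHM pMH prf Mf; have [Hf ff nzf _] := prf.
have [sHM nHM] := andP nsHM.
have csH L : (L \in classes M) && (L \subset H) -> in_center H (gsum k L).
  case/andP=> /imsetP[x xM ->] sxH; apply: in_center_gsum => //.
  by apply: subset_trans (class_norm x M).
have [mu Hmu] : exists mu : {set gT} -> k, forall L,
    (L \in classes M) && (L \subset H) ->
      nilpotent_elt ((gsum k L - (mu L)%:A) * f).
  suff /fin_all_exists[mu Hmu] : forall L : {set gT}, exists u : k,
    (L \in classes M) && (L \subset H) ->
      nilpotent_elt ((gsum k L - u%:A) * f) by exists mu.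
  move=> L.
  have [Lok | _] := boolP (_ && _); last by exists 0.
  by have [u nu] := central_eigenvalue prf (csH L Lok); exists u.
have HsuA (u : k) : in_center H (u%:A : A) by apply/in_centerZ/in_center1.
have fnil : ~ nilpotent_elt f by move/(idem_nilpotent ff)/eqP; apply/negP.
have [L /and3P[Lok nzfL nzmu]] : exists L,
    [&& (L \in classes M) && (L \subset H), f (repr L) != 0 & mu L != 0].
  (* Otherwise f would be a sum of commuting nilpotent elements. *)
  apply/existsP; apply: contra_notT fnil => /existsPn all0.
  rewrite -ff {1}(class_sum_expansion nsHM Hf.1 Mf) mulr_suml.
  apply: (nilpotent_elt_sum (H := H)) => L Lok; split.
    by apply: in_centerM Hf; apply/in_centerZ/csH.
  rewrite -scalerAl; have:= all0 L; rewrite Lok /=.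
  have [-> _ | _] := eqVneq (f (repr L)) 0.
    by exists 1%N; rewrite scale0r expr1.
  rewrite /= negbK => /eqP mu0; apply: nilpotent_eltZ.
  by have:= Hmu L Lok; rewrite mu0 scale0r subr0.
have /andP[/repr_classesP[gM DL] sLH] := Lok.
set g := repr L in gM DL nzfL; have gH : g \in H.
  by apply: (subsetP sLH); rewrite DL class_refl.
have nuL := Hmu L Lok.
have Kcenter a : in_center H a -> in_center H ((a - (mu L)%:A) * f).
  by move=> Ha; apply: in_centerM Hf; apply: in_centerB.
have muf : (mu L) *: f = gsum k L * f - (gsum k L - (mu L)%:A) * f.
  by rewrite mulrBl opprB addrC subrK mulr_algl.
have not_nil_muf : ~ nilpotent_elt ((mu L) *: f).
  by move/(nilpotent_eltZ (mu L)^-1); rewrite scalerA mulVf // scale1r.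
have gMH : g ^: M = g ^: H.
  have gHc : in_center H (gsum k (g ^: H)).
    by apply: in_center_gsum; rewrite ?class_norm // class_sub_norm ?normG.
  have [u nu] := central_eigenvalue prf gHc.
  have [// | nL] := class_sum_nilpotent chp nsHM pMH Hf Mf nu gH.
  case: not_nil_muf; rewrite muf -DL in nL *; apply: nilpotent_eltD => //.
    apply: (@in_centerC _ _ H); last exact/in_centerN/Kcenter/csH.
    by apply: in_centerM Hf; apply: csH.
  by rewrite -scaleN1r; apply/nilpotent_eltZ/Hmu.
exists g; split=> // R pR sRH nzR.
apply/exists_inP; apply: contraNT nzR => /exists_inPn noh.
have tL0 : trunc 'C(R) (gsum k L) = 0.
  apply/ffunP=> h; rewrite !ffunE; case: ifP => // hC.
  case: (boolP (h \in L)) => // hL.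
  by rewrite (negPf (noh h _)) // -gMH -DL in hC *.
have cfR a : in_center H a -> class_fun R a.
  by case=> _ Ha x h /(subsetP sRH); apply: Ha.
have tff : trunc 'C(R) f * trunc 'C(R) f = trunc 'C(R) f.
  by rewrite -(trunc_mul chp pR) ?ff //; apply: cfR.
apply/eqP/(idem_nilpotent tff).
suff /(nilpotent_eltZ (mu L)^-1) : nilpotent_elt (mu L *: trunc 'C(R) f)
  by rewrite scalerA mulVf // scale1r.
have tZ (u : k) a : trunc 'C(R) (u *: a) = u *: trunc 'C(R) a.
  by apply/ffunP=> h; rewrite !ffunE; case: ifP; rewrite ?scaler0.
rewrite -tZ muf truncD (trunc_mul chp pR); try exact/cfR/csH; try exact: cfR.
rewrite tL0 mul0r add0r -scaleN1r tZ; apply: nilpotent_eltZ.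
apply: (trunc_nilpotent chp pR) => //; apply: cfR; exact/Kcenter/csH.
Qed.

End Defect.

(** * Blocks below a central idempotent *)

Section Blocks.
Variables (k : fieldType) (gT : finGroupType).
Local Notation A := (galg k gT).
Implicit Types (a b c e f z : A) (g h x y : gT) (D G H M P Q R : {group gT}).

HB.instance Definition _ := Vector.on (galg k gT).

Lemma block_dichotomy H f c : block_idem H f -> in_center H c ->
  c * c = c -> f * c = f \/ f * c = 0.
Proof.
move=> [Hf ff _ prim] Hc cc.
have fcf : f * c * f = f * c by rewrite -mulrA (in_centerC Hc Hf) mulrA ff.
have fcfc : f * c * (f * c) = f * c by rewrite mulrA fcf -mulrA cc.
have ffc : f * (f * c) = f * c by rewrite mulrA ff.
case: (prim (f * c) (f - f * c)) => [||||||->|/eqP]; [..|by right|].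
- exact: in_centerM.
- by apply: in_centerB => //; apply: in_centerM.
- by [].
- by rewrite mulrBl !mulrBr ff ffc fcf fcfc subrr subr0.
- by rewrite mulrBr fcf fcfc subrr.
- by rewrite addrC subrK.
by rewrite subr_eq0 eq_sym => /eqP; left.
Qed.

(** The dimension of the ideal generated by an idempotent c: it consists of
    the elements fixed by multiplication by c. *)
Definition idem_rank c := \dim (fixedSpace (linfun (c \*o idfun))).

Lemma idem_rank_lt c d : c * c = c -> c * d = d -> d * c = d -> d != c ->
  (idem_rank d < idem_rank c)%N.
Proof.
move=> cc cd dc ne; set Fd := fixedSpace (linfun (d \*o idfun)).
have sF : (Fd <= fixedSpace (linfun (c \*o idfun)))%VS.
  apply/subvP=> v /fixedSpaceP; rewrite lfunE /= => dv.
  by apply/fixedSpaceP; rewrite lfunE /= -dv mulrA cd.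
rewrite /idem_rank ltn_neqAle dimvS // andbT (dimv_leqif_eq sF).
apply: contraNneq ne => EF; rewrite -dc; apply/eqP.
have /fixedSpaceP : c \in Fd by rewrite EF; apply/fixedSpaceP; rewrite lfunE.
by rewrite lfunE.
Qed.

(** A central idempotent that is not primitive has a nonzero central
    idempotent of smaller rank below it. *)
Lemma exists_block_below H c : in_center H c -> c * c = c -> c != 0 ->
  exists2 f, block_idem H f & f * c = f.
Proof.
have [n] := ubnP (idem_rank c); elim: n c => // n IHn c lt_c_n Hc cc nzc.
have [[d [[Hd dd nzd] cd ne_dc]] | noD] := classic (exists d,
  [/\ [/\ in_center H d, d * d = d & d != 0], c * d = d & d != c]).
  have dc : d * c = d by rewrite (in_centerC Hd Hc).
  have [|f prf fd] := IHn d _ Hd dd nzd.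
    by apply: leq_trans (idem_rank_lt cc cd dc ne_dc) _.
  by exists f; rewrite // -fd -mulrA dc.
exists c => //; split=> // f1 f2 Hf1 Hf2 ff1 ff2 f12 Dc.
have [-> | nz1] := eqVneq f1 0; first by left.
have [-> | nz2] := eqVneq f2 0; first by right.
case: noD; exists f1; split=> //.
  by rewrite Dc mulrDl ff1 (in_centerC Hf2 Hf1) f12 addr0.
by rewrite Dc -subr_eq0 opprD addNKr oppr_eq0.
Qed.

Lemma in_center_conj H y a : y \in 'N(H) -> in_center H a ->
  in_center H (conj_galg y a).
Proof.
move=> nHy [sa ca]; have nHV : (y^-1 \in 'N(H))%g by rewrite groupV.
split=> [h nh | g h gH]; rewrite !ffunE; first by rewrite sa // memJ_norm.
by rewrite conjJg ca // memJ_norm.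
Qed.

(** Remove from c, one after the other, the stable blocks killed by Br_D and
    the sums f + f^y with f^y <> f. As y lies in D, the functions f and f^y
    agree on C(D), so Br_D kills such a sum in characteristic 2. Hence Br_D
    does not change in the process, which therefore stops at a suitable f. *)
Lemma stable_block_below H y D c : 2%N \in [pchar k] -> y \in 'N(H) ->
    (y ^+ 2 \in H)%g -> y \in D ->
    in_center H c -> c * c = c -> class_fun [set y] c -> trunc 'C(D) c != 0 ->
  exists f, [/\ block_idem H f, f * c = f, class_fun [set y] f
    & trunc 'C(D) f != 0].
Proof.
move=> ch2 nHy y2H yD; have [n] := ubnP (idem_rank c).
elim: n c => // n IHn c lt_c_n Hc cc yc nztc.
have nzc : c != 0 by apply: contraNneq nztc => ->; rewrite trunc0.
have [f prf fc] := exists_block_below Hc cc nzc.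
have [Hf ff nzf _] := prf.
have conj_y a : conj_galg y a = a -> class_fun [set y] a.
  by move/ffunP=> Ea x h /set1P->; rewrite -(Ea (h ^ y)%g) ffunE conjgK.
(* The idempotent s is what can be removed from c when f does not fit. *)
have : (exists s,
     [/\ in_center H s, s * s = s, s != 0, s * c = s & class_fun [set y] s]
     /\ trunc 'C(D) s = 0) \/
  exists f, [/\ block_idem H f, f * c = f,
    class_fun [set y] f & trunc 'C(D) f != 0].
  have [fyE | fyN] := eqVneq (conj_galg y f) f.
    have yf := conj_y _ fyE.
    have [tf0 | ntf] := eqVneq (trunc 'C(D) f) 0; last by right; exists f.
    by left; exists f.
  left; exists (f + conj_galg y f).
  have Hfy := in_center_conj nHy Hf.
  have fyfy : conj_galg y f * conj_galg y f = conj_galg y f.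
    by rewrite -conj_galgM ff.
  have fyy : conj_galg y (conj_galg y f) = f.
    apply/ffunP=> h; rewrite !ffunE -conjgM -invMg.
    by rewrite Hf.2 ?groupV.
  have ffy : f * conj_galg y f = 0.
    have [E | //] := block_dichotomy prf Hfy fyfy.
    case/eqP: fyN; have := congr1 (conj_galg y) E.
    by rewrite conj_galgM fyy => <-; rewrite (in_centerC Hfy Hf).
  have fyf : conj_galg y f * f = 0 by rewrite (in_centerC Hfy Hf).
  have yD2 : forall a b, conj_galg y (a + b) = conj_galg y a + conj_galg y b.
    by move=> a b; apply/ffunP=> h; rewrite !ffunE.
  split; first split.
  + exact: in_centerD.
  + by rewrite mulrDl !mulrDr ff ffy fyf fyfy addr0 add0r.
  + apply: contraNneq nzf => /(congr1 ( *%R f)).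
    by rewrite mulrDr ff ffy addr0 mulr0 => ->.
  + by rewrite mulrDl fc -{1}(conj_galg_id yc) -conj_galgM fc.
  + by apply: conj_y; rewrite yD2 fyy addrC.
  apply/ffunP=> h; rewrite !ffunE; case: ifP => // hC.
  rewrite (_ : h ^ y^-1 = h)%g; last first.
    by apply/conjg_fixP/commgP; exact: commuteV (centP hC y yD).
  by rewrite -mulr2n -mulr_natl (pcharf0 ch2) mul0r.
case=> [[s [[Hs ss nzs cs ys] ts0]] | //].
have cs' : c * s = s by rewrite (in_centerC Hc Hs).
have dd : (c - s) * (c - s) = c - s.
  by rewrite mulrBl !mulrBr cc ss cs cs' subrr subr0.
have cd : c * (c - s) = c - s by rewrite mulrBr cc cs'.
have dc : (c - s) * c = c - s by rewrite mulrBl cc cs.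
have [|||||f' [prf' fd yf ntf]] := IHn (c - s).
- apply: leq_trans (idem_rank_lt cc cd dc _) _; last by [].
  by rewrite -subr_eq0 addrAC subrr add0r oppr_eq0.
- exact: in_centerB.
- exact: dd.
- by move=> x h xy; rewrite !ffunE yc ?ys.
- by apply: contraNneq nztc => E; rewrite -[c](subrK s) truncD ts0 addr0 E.
by exists f'; split=> //; rewrite -fd -mulrA dc.
Qed.

End Blocks.

Section Trunc.
Variables (k : fieldType) (gT : finGroupType).
Local Notation A := (galg k gT).
Implicit Types (a b c e f z : A) (g h x y : gT) (D G H M P Q R : {group gT}).

Lemma trunc_neq0S (S T : {set gT}) a : S \subset T -> trunc S a != 0 ->
  trunc T a != 0.
Proof.
by move=> sST; apply: contraNneq => E; rewrite -(trunc_trunc a sST) E trunc0.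
Qed.

Lemma class_fun_join H y a : class_fun H a -> class_fun [set y] a ->
  class_fun (H <*> <[y]>) a.
Proof.
move=> Ha ya; pose T := [set g | [forall h, a (h ^ g)%g == a h]].
have gT0 : group_set T.
  apply/group_setP; split=> [|g1 g2].
    by rewrite inE; apply/forallP=> h; rewrite conjg1.
  rewrite !inE => /forallP T1 /forallP T2; apply/forallP=> h.
  by rewrite conjgM (eqP (T2 _)) (eqP (T1 _)).
suff sMT : H <*> <[y]> \subset Group gT0.
  by move=> g h /(subsetP sMT); rewrite inE => /forallP/(_ h)/eqP.
rewrite join_subG cycle_subG; apply/andP; split.
  by apply/subsetP=> g gH; rewrite inE; apply/forallP=> h; rewrite Ha.
by rewrite inE; apply/forallP=> h; rewrite ya ?set11.
Qed.

Lemma class_fun_trunc (M : {set gT}) P a : M \subset 'N(P) -> class_fun M a ->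
  class_fun M (trunc 'C(P) a).
Proof.
move=> nPM Ma g h gM; rewrite !ffunE Ma // memJ_norm //.
by rewrite (subsetP (cent_norm P)) // (subsetP nPM).
Qed.

Lemma in_center_trunc H P a : P \subset H -> in_center H a ->
  in_center 'C_H(P) (trunc 'C(P) a).
Proof.
move=> sPH [sa ca]; split=> [h | ].
  by rewrite inE negb_and !ffunE => /orP[nh|/negPf->//]; rewrite sa ?if_same.
apply: class_fun_trunc; first by rewrite subIset // cent_sub orbT.
by move=> g h /setIP[gH _]; apply: ca.
Qed.

Lemma idem_trunc (p : nat) P a : p \in [pchar k] -> p.-group P ->
  class_fun P a -> a * a = a ->
  trunc 'C(P) a * trunc 'C(P) a = trunc 'C(P) a.
Proof. by move=> chp pP Pa aa; rewrite -(trunc_mul chp pP) // aa. Qed.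

Lemma trunc_le_neq0 (p : nat) Q b c : p \in [pchar k] -> p.-group Q ->
  class_fun Q b -> class_fun Q c ->
  b * c = b -> trunc 'C(Q) b != 0 -> trunc 'C(Q) c != 0.
Proof.
move=> chp pQ Qb Qc bc; apply: contraNneq => E.
by rewrite -bc (trunc_mul chp pQ) // E mulr0.
Qed.

Lemma class_funS (S T : {set gT}) a : S \subset T -> class_fun T a ->
  class_fun S a.
Proof. by move=> sST Ta g h /(subsetP sST); apply: Ta. Qed.

(** The case y = 1 of [stable_block_below], for the idempotent Br_P(c). *)
Lemma block_below_brauer G c P Q : 2%N \in [pchar k] -> in_center G c ->
    c * c = c -> P \subset G -> 2%N.-group P -> P \subset Q ->
    trunc 'C(Q) c != 0 ->
  exists f, [/\ block_idem 'C_G(P) f, f * trunc 'C(P) c = f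
    & trunc 'C(Q) f != 0].
Proof.
move=> ch2 Hc cc sPG pP sPQ nz.
have cP : class_fun P c by apply: class_funS sPG Hc.2.
have [||||||||f [prf fc _ nzf]] :=
  @stable_block_below k gT 'C_G(P)%G 1 Q (trunc 'C(P) c).
- exact: ch2.
- exact: group1.
- by rewrite expg1n group1.
- exact: group1.
- exact: in_center_trunc.
- exact: idem_trunc ch2 pP cP cc.
- by move=> x h /set1P->; rewrite conjg1.
- by rewrite trunc_trunc // centS.
by exists f.
Qed.

(** * Defect groups *)

Definition is_defect (p : nat) (G : {set gT}) f D :=
  [max D | [&& D \subset G, p.-group D & trunc 'C(D) f != 0]].

Lemma is_defect_exists (p : nat) H f P : P \subset H -> p.-group P ->
    trunc 'C(P) f != 0 ->
  exists2 R, is_defect p H f R & P \subset R.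
Proof.
move=> sPH pP nz.
pose gP (D : {group gT}) :=
  [&& D \subset H, p.-group D & trunc 'C(D) f != 0].
have [|R maxR sPR] := @maxgroup_exists _ gP P; first exact/and3P.
by exists R.
Qed.

End Trunc.

Section Main.
Variables (k : closedFieldType) (gT : finGroupType).
Local Notation A := (galg k gT).
Implicit Types (a b c f z : A) (g h x y t u v : gT).
Implicit Types (D G H M P Q R : {group gT}).

(** If g is given by [defect_class] with M = H, then every p-subgroup R with
    Br_R(f) <> 0 centralizes a conjugate of g. So R lies in a conjugate of a
    Sylow subgroup S of the centralizer of g, while Br_S(f) <> 0 because f does
    not vanish at g. *)
Lemma defect_contains_conj (p : nat) G f D R : p \in [pchar k] ->
  block_idem G f -> is_defect p G f D ->
    R \subset G -> p.-group R -> trunc 'C(R) f != 0 ->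
  exists2 x, x \in G & R \subset D :^ x.
Proof.
move=> chp prf /maxgroupP[/and3P[sDG pD nzD] maxD] sRG pR nzR.
have [Hf _ _ _] := prf.
have pGG : p.-group (G / G) by rewrite trivg_quotient pgroup1.
have [g [gG nzfg _ cls]] := defect_class chp (normal_refl G) pGG prf Hf.2.
have [S sylS] := Sylow_exists p 'C_G[g].
have [sSC pS _] := and3P sylS; have [sSG cgS] := subsetIP sSC.
have inS Q : Q \subset G -> p.-group Q -> trunc 'C(Q) f != 0 ->
  exists2 x, x \in G & Q \subset S :^ x.
  move=> sQG pQ nzQ; have [_ /imsetP[x xG ->] gxC] := cls Q pQ sQG nzQ.
  have sQC : Q :^ x^-1 \subset 'C_G[g].
    by rewrite sub_conjgV conjIg conjGid // subsetI sQG -cent1J sub_cent1.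
  have pQx : p.-group (Q :^ x^-1) by rewrite pgroupJ.
  have [y /setIP[yG _] sQS] := Sylow_subJ sylS sQC pQx.
  exists (y * x)%g; first by rewrite groupM.
  by rewrite conjsgM -sub_conjgV.
have [x1 x1G sDS] := inS D sDG pD nzD; have [x2 x2G sRS] := inS R sRG pR nzR.
have gCS : g \in 'C(S) by rewrite -sub_cent1; case/subsetIP: sSC.
have DS : S :^ x1 = D.
  apply: maxD => //; rewrite /= pgroupJ pS -{1}(conjGid x1G) conjSg sSG /=.
  apply: contraNneq nzfg => /ffunP/(_ (g ^ x1)%g).
  by rewrite !ffunE centJ memJ_conjg gCS Hf.2 // => ->.
exists (x1^-1 * x2)%g; first by rewrite groupM ?groupV.
by rewrite -DS -conjsgM mulKVg.
Qed.

(** * A block all of whose subsections are major *)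

Variables (G : {group gT}) (e : A).
Hypothesis ch2 : 2%N \in [pchar k].
Hypothesis pre : block_idem G e.
Hypothesis all_major : forall x f, x \in G -> 2%N.-elt x ->
  block_idem 'C_G(<[x]>) f -> trunc 'C(<[x]>) e * f != 0 ->
  forall R, is_defect 2%N 'C_G(<[x]>) f R -> is_defect 2%N G e R.

(** If f lies below Br_x(e), then (x, f) is a subsection, which is major. *)
Lemma subsection_defect x f R : x \in G -> 2%N.-elt x ->
  block_idem 'C_G(<[x]>) f -> f * trunc 'C(<[x]>) e = f ->
  is_defect 2%N 'C_G(<[x]>) f R -> is_defect 2%N G e R.
Proof.
move=> xG x2 prf fe; apply: all_major => //; have [Hf _ nzf _] := prf.
have [He _ _ _] := pre.
have Hc : in_center 'C_G(<[x]>) (trunc 'C(<[x]>) e).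
  by apply: in_center_trunc; rewrite ?cycle_subG.
by rewrite (in_centerC Hc Hf) fe.
Qed.

(** Otherwise a inverts x = ab without centralizing it, and a block of C_G(x)
    below Br_x(e) that is stable under a would have, in C_G(x)<a>, a larger
    defect than e. *)
Lemma involutions_commute D (a b : gT) : is_defect 2%N G e D -> a \in D ->
  b \in D -> (a ^+ 2 = 1)%g -> (b ^+ 2 = 1)%g -> commute a b.
Proof.
move=> /maxgroupP[/and3P[sDG pD nzD] _] aD bD a2 b2.
have [He ee nze _] := pre.
set x := (a * b)%g.
have aV : (a^-1 = a)%g by apply: (mulgI a); rewrite mulgV -a2.
have bV : (b^-1 = b)%g by apply: (mulgI b); rewrite mulgV -b2.
have xa : (x ^ a = x^-1)%g by rewrite /x /conjg invMg aV bV mulgA -{1}aV mulKg.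
have xD : x \in D by rewrite groupM.
have [xG aG] := (subsetP sDG x xD, subsetP sDG a aD).
have x2 : 2%N.-elt x := mem_p_elt pD xD.
have [axC | naxC] := boolP (a \in 'C(<[x]>)).
  have E : (a * x = x * a)%g by apply: (centP axC); apply: cycle_id.
  by apply: (mulgI a); rewrite -/x E mulgA.
pose H := 'C_G(<[x]>)%G; pose M := (H <*> <[a]>)%G.
have sXG : <[x]> \subset G by rewrite cycle_subG.
have nXa : <[a]> \subset 'N(<[x]>) by rewrite cycle_subG inE -cycleJ xa cycleV.
have nHa : <[a]> \subset 'N(H).
  by rewrite normsI ?norms_cent // normsG // cycle_subG.
have nsHM : H <| M by rewrite normalYl.
have sMG : M \subset G by rewrite join_subG subsetIl cycle_subG.
have nXM : M \subset 'N(<[x]>).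
  by rewrite join_subG nXa andbT subIset // cent_sub orbT.
set c := trunc 'C(<[x]>) e.
have sXD : <[x]> \subset D by rewrite cycle_subG.
have pX : 2%N.-group <[x]> := pgroupS sXD pD.
have Hc : in_center H c by apply: in_center_trunc.
have cM : class_fun M c by apply: class_fun_trunc nXM _;
  apply: class_funS sMG He.2.
have cc : c * c = c by apply: idem_trunc ch2 pX _ ee;
  apply: class_funS sXG He.2.
have aM : a \in M by rewrite mem_gen // inE cycle_id orbT.
have [|||||||f [prf fc af _]] := @stable_block_below k gT H a D c ch2.
- by rewrite -cycle_subG.
- by rewrite a2 group1.
- exact: aD.
- exact: Hc.
- exact: cc.
- by apply: class_funS cM; rewrite sub1set.
- by rewrite trunc_trunc // centS.
have [Hf _ nzf _] := prf.
have fM : class_fun M f by apply: class_fun_join => //; case: Hf.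
have pMH : 2%N.-group (M / H).
  by rewrite /= quotientYidl // quotient_pgroup // (pgroupS _ pD) // cycle_subG.
have [g [gH nzfg gMH cls]] := defect_class ch2 nsHM pMH prf fM.
have [R defR _] : exists2 R, is_defect 2%N H f R & 1%G \subset R.
  apply: is_defect_exists; rewrite ?sub1G ?pgroup1 //.
  by apply: contraNneq nzfg => /ffunP/(_ g); rewrite !ffunE cent1T inE => ->.
have defRG := subsection_defect xG x2 prf fc defR.
have /maxgroupP[/and3P[sRH pR nzR] _] := defR.
have [h hg hC] := cls R pR sRH nzR.
have ghH : h ^: H = g ^: H by apply/class_eqP.
have xCg : <[x]> \subset 'C_M[g].
  rewrite cycle_subG inE cent1C -cent_cycle; case/setIP: gH => _ ->.
  by rewrite mem_gen // inE [x \in H]inE xG -cycle_subG -abelianE cycle_abelian.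
have [S sylS sXS] := Sylow_superset xCg pX.
have [sSC pS _] := and3P sylS; have [sSM cgS] := subsetIP sSC.
have nzS : trunc 'C(S) f != 0.
  by apply: contraNneq nzfg => /ffunP/(_ g);
    rewrite !ffunE -sub_cent1 cgS => ->.
have nzSe : trunc 'C(S) e != 0.
  rewrite -(trunc_trunc e (centS sXS)).
  apply: trunc_le_neq0 ch2 pS _ _ fc nzS; exact: class_funS sSM _.
have [z zG sSRz] :=
  defect_contains_conj ch2 pre defRG (subset_trans sSM sMG) pS nzSe.
(* The orders: |S| is the 2-part of |M : H| |C_H(h)|, and |R| divides the
   2-part of |C_H(h)|. *)
have: (#|S| <= #|R|)%N by rewrite -(cardJg R z) subset_leq_card.
rewrite leqNgt => /negP[].
have oC : #|'C_M[g]| = (#|'C_H[h]| * #|M : H|)%N.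
  have nM : (#|'C_M[g]| * #|g ^: H| = #|M|)%N
    by rewrite -gMH -index_cent1 Lagrange ?subsetIl.
  have nH : (#|'C_H[h]| * #|g ^: H| = #|H|)%N
    by rewrite -ghH -index_cent1 Lagrange ?subsetIl.
  apply/eqP; rewrite -(eqn_pmul2r (_ : 0 < #|g ^: H|)%N); last first.
    by rewrite -index_cent1.
  by rewrite nM mulnAC nH Lagrange // normal_sub.
rewrite (card_Hall sylS) oC partnM ?cardG_gt0 ?indexg_gt0 //.
have leR : (#|R| <= #|'C_H[h]|`_2)%N.
  rewrite -(part_pnat_id pR) dvdn_leq ?part_gt0 // partn_dvd ?cardG_gt0 //.
  by rewrite cardSg // subsetI sRH sub_cent1.
apply: leq_ltn_trans leR _; rewrite ltn_Pmulr ?part_gt0 //.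
rewrite part_pnat_id; last by rewrite -card_quotient ?normal_norm.
rewrite indexg_gt1.
apply: contra naxC => sMH; have /setIP[] // := subsetP sMH a aM.
Qed.

(** The block b of C_G(u) is below Br_u(e), so no larger subgroup can have a
    nonzero Brauer image of b. *)
Lemma defect_in_cent D u b : is_defect 2%N G e D -> u \in 'Z(D) ->
    in_center 'C_G(<[u]>) b -> b * trunc 'C(<[u]>) e = b ->
    trunc 'C(D) b != 0 ->
  is_defect 2%N 'C_G(<[u]>) b D.
Proof.
move=> /maxgroupP[/and3P[sDG pD nzD] maxD] /setIP[uD uC] Hb be nzb.
have [He _ _ _] := pre.
have sUG : <[u]> \subset G by rewrite cycle_subG (subsetP sDG).
have [_ cc] : in_center 'C_G(<[u]>) (trunc 'C(<[u]>) e).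
  by apply: in_center_trunc.
apply/maxgroupP; rewrite subsetI sDG pD nzb cent_cycle sub_cent1 uC.
split=> // D1.
case/and3P=> /subsetIP[sD1G cD1u] pD1 nzD1 sDD1; apply: maxD => //.
rewrite sD1G pD1 /= -(@trunc_trunc _ _ _ 'C(<[u]>)); last first.
  by rewrite centS // cycle_subG (subsetP sDD1).
have sD1 : D1 \subset 'C_G(<[u]>) by rewrite subsetI sD1G cent_cycle.
apply: trunc_le_neq0 ch2 pD1 _ _ be nzD1; first exact: class_funS sD1 Hb.2.
exact: class_funS sD1 cc.
Qed.

(** The defect groups D and R, whose centers contain u and t respectively,
    belong to the same block b of C_G(u), hence are conjugate by an element
    that commutes with u. *)
Lemma square_root_in_center D t : is_defect 2%N G e D -> t \in D ->
  (t ^+ 2)%g \in 'Z(D) ->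
  exists2 z, z \in 'Z(D) & (z ^+ 2 = t ^+ 2)%g.
Proof.
move=> defD tD; set u := (t ^+ 2)%g => uZ.
have /maxgroupP[/and3P[sDG pD nzD] _] := defD.
have [He ee _ _] := pre; have [uD cDu] := setIP uZ.
have [uG tG] := (subsetP sDG u uD, subsetP sDG t tD).
have pU : 2%N.-group <[u]> := mem_p_elt pD uD.
have pT : 2%N.-group <[t]> := mem_p_elt pD tD.
have [sUG sTG] : <[u]> \subset G /\ <[t]> \subset G by rewrite !cycle_subG.
have sUT : <[u]> \subset <[t]> by rewrite cycle_subG mem_cycle.
have [|b [prb be nzb]] := block_below_brauer ch2 He ee sUG pU _ nzD.
  by rewrite cycle_subG.
have [Hb bb _ _] := prb.
have sTCu : <[t]> \subset 'C_G(<[u]>).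
  by rewrite subsetI sTG (subset_trans (cycle_abelian t)) // centS.
have [|f [prf fb nzf]] :=
  @block_below_brauer _ _ 'C_G(<[u]>)%G b <[t]> D ch2 Hb bb sTCu pT _ nzb.
  by rewrite cycle_subG.
have CCt : 'C_('C_G(<[u]>))(<[t]>) = 'C_G(<[t]>).
  by rewrite -setIA; congr (_ :&: _); apply/setIidPr/centS.
rewrite /= CCt in prf; have [Hf _ nzf0 _] := prf.
have cT a : in_center 'C_G(<[u]>) a -> class_fun <[t]> a.
  by case=> _; apply: class_funS.
have Hc : in_center 'C_G(<[u]>) (trunc 'C(<[u]>) e) by apply: in_center_trunc.
have fe : f * trunc 'C(<[t]>) e = f.
  rewrite -(trunc_trunc e (centS sUT)) -{1}fb -mulrA.
  by rewrite -(trunc_mul ch2 pT) ?be //; apply: cT.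
have [||R defR sTR] := @is_defect_exists _ _ 2%N 'C_G(<[t]>)%G f <[t]> _ pT.
- by rewrite subsetI sTG; apply: cycle_abelian.
- rewrite (_ : trunc _ f = f) //; apply/ffunP=> h; rewrite ffunE.
  case: ifP => // nh.
  by rewrite Hf.1 // inE nh andbF.
have defRG := subsection_defect tG pT prf fe defR.
have /maxgroupP[/and3P[sRC pR nzR] _] := defR.
have tR : t \in R by rewrite -cycle_subG.
have [sRG cRt] := subsetIP sRC.
have tZ : t \in 'Z(R) by rewrite inE tR -sub_cent1 -cent_cycle.
have uZR : u \in 'Z(R) by rewrite groupX.
have sRCu : R \subset 'C_G(<[u]>).
  by rewrite subsetI sRG (subset_trans cRt) // centS.
have nzbR : trunc 'C(R) b != 0.
  rewrite -(trunc_trunc b (centS sTR)).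
  apply: trunc_le_neq0 ch2 pR _ _ fb nzR; first exact: class_funS sRC Hf.2.
  apply: class_fun_trunc; first exact: subset_trans (cents_norm cRt).
  exact: class_funS sRCu Hb.2.
have defDb := defect_in_cent defD uZ Hb be nzb.
have defRb := defect_in_cent defRG uZR Hb be nzbR.
have sDCu : D \subset 'C_G(<[u]>) by rewrite subsetI sDG cent_cycle sub_cent1.
have prbG : block_idem 'C_G(<[u]>)%G b := prb.
have [x /setIP[_ xC] sRDx] :=
  defect_contains_conj ch2 prbG defDb sRCu pR nzbR.
have [y _ sDRy] := defect_contains_conj ch2 prbG defRb sDCu pD nzb.
have DR : R :=: (D :^ x)%g.
  by apply/eqP; rewrite eqEcard sRDx cardJg -(cardJg R y) subset_leq_card.
exists (t ^ x^-1)%g; first by rewrite -mem_conjg /center conjIg -centJ -DR.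
rewrite -conjXg -/u; apply/conjg_fixP/commgP/commuteV/commute_sym.
by apply: (centP xC); apply: cycle_id.
Qed.

(** The induction is on the order of t, for all defect groups at once: the
    step is carried out in a defect group R that contains t and v and has t^2
    in its center. *)
Lemma involution_central n D t v : is_defect 2%N G e D -> t \in D -> v \in D ->
  (t ^+ (2 ^ n) = 1)%g -> (v ^+ 2 = 1)%g -> commute t v.
Proof.
elim: n D t v => [|n IHn] D t v defD tD vD.
  by rewrite expg1 => -> _; apply/commute_sym/commute1.
rewrite expnS expgM => tn v2; set u := (t ^+ 2)%g in tn.
have uD : u \in D by rewrite groupX.
have cuv : commute u v by apply: (IHn D).
have /maxgroupP[/and3P[sDG pD nzD] _] := defD.
have [He ee _ _] := pre; have uG := subsetP sDG u uD.
have pU : 2%N.-group <[u]> := mem_p_elt pD uD.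
have sUG : <[u]> \subset G by rewrite cycle_subG.
pose Q := 'C_D(<[u]>)%G.
have inQ w : w \in D -> commute u w -> w \in Q.
  by move=> wD cuw; apply/setIP; split=> //; rewrite /= cent_cycle;
    apply/cent1P.
have nzQ : trunc 'C(Q) e != 0.
  by apply: trunc_neq0S nzD; rewrite centS ?subsetIl.
have uQ : u \in Q by apply: inQ.
have [|b [prb be nzb]] := block_below_brauer ch2 He ee sUG pU _ nzQ.
  by rewrite cycle_subG.
have pQ : 2%N.-group Q := pgroupS (subsetIl _ _) pD.
have sQC : Q \subset 'C_G(<[u]>) by apply: setSI.
have [R defR /subsetP sQR] := is_defect_exists sQC pQ nzb.
have defRG := subsection_defect uG pU prb be defR.
have /maxgroupP[/and3P[/subsetIP[sRG cRu] pR nzR] _] := defR.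
have tR : t \in R by apply/sQR/inQ => //; apply/commute_sym/commuteX.
have vR : v \in R by apply/sQR/inQ.
have uZ : u \in 'Z(R) by rewrite inE sQR // -sub_cent1 -cent_cycle.
have [z /setIP[zR zC] z2] := square_root_in_center defRG tR uZ.
have cz w : w \in R -> commute z w by move=> wR; apply: (centP zC).
have w2 : ((t * z^-1) ^+ 2 = 1)%g.
  by rewrite expgMn ?expgVn ?z2 ?mulgV //; apply/commuteV/commute_sym/cz.
have := involutions_commute defRG (_ : t * z^-1 \in R)%g vR w2 v2.
rewrite groupM ?groupV // => /(_ isT) cwv.
rewrite -(mulgKV z t); apply: commute_sym.
by apply: commuteM; apply: commute_sym => //; apply: cz.
Qed.

(** Every element t of D is central, by induction on its order: t^2 has a
    square root z in Z(D), and t z^-1 has square 1. *)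
Theorem defect_abelian D : is_defect 2%N G e D -> abelian D.
Proof.
move=> defD; have /maxgroupP[/and3P[sDG pD _] _] := defD.
suff sDZ n t : t \in D -> (t ^+ (2 ^ n) = 1)%g -> t \in 'Z(D).
  apply/subsetP=> t tD; have [n tn] := p_natP (mem_p_elt pD tD).
  by have /setIP[] : t \in 'Z(D) by apply: (sDZ n) => //;
    rewrite -tn expg_order.
elim: n t => [|n IHn] t tD; first by rewrite expg1 => ->; apply: group1.
rewrite expnS expgM => tn.
have uZ : (t ^+ 2)%g \in 'Z(D) by apply: IHn; rewrite ?groupX.
have [z zZ z2] := square_root_in_center defD tD uZ; have [zD zC] := setIP zZ.
have w2 : ((t * z^-1) ^+ 2 = 1)%g.
  by rewrite expgMn ?expgVn ?z2 ?mulgV //;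
    apply/commuteV/commute_sym/(centP zC).
rewrite -(mulgKV z t) groupM // inE groupM ?groupV //=.
apply/centP=> s sD; have [m sm] := p_natP (mem_p_elt pD sD).
apply: commute_sym; apply: (involution_central (n := m) defD) => //.
  by rewrite groupM ?groupV.
by rewrite -sm expg_order.
Qed.

End Main.

(** * The matrix model of group algebras *)

Section Matrices.
Variables (k : fieldType) (gT : finGroupType).
Local Notation A := (galg k gT).
Implicit Types (a b c f : A) (g h x y : gT) (D G H M P Q R : {group gT}).

Definition galg_of_mx G (m : 'M[k]_#|G|) : A :=
  [ffun g => if g \in G then gr_coef m g else 0].

Definition mx_of_galg G a : 'M[k]_#|G| :=
  \sum_(g in G) a g *: regular_repr k G g.

Lemma supported_galg_of_mx G (m : 'M[k]_#|G|) : supported G (galg_of_mx m).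
Proof. by move=> h nh; rewrite ffunE (negPf nh). Qed.

Lemma mx_of_galgK G a : supported G a -> galg_of_mx (mx_of_galg G a) = a.
Proof.
move=> Ga; apply/ffunP=> g; rewrite ffunE.
by case: (boolP (g \in G)) => [gG | /Ga->//]; rewrite gr_coef_sum.
Qed.

Lemma galg_of_mxK G (m : 'M[k]_#|G|) : (m \in group_ring k G)%MS ->
  mx_of_galg G (galg_of_mx m) = m.
Proof.
case/envelop_mxP=> l Dm; rewrite [RHS]Dm; apply: eq_bigr => g gG.
by rewrite ffunE gG Dm gr_coef_sum.
Qed.

Lemma mx_of_galg_ring G a : (mx_of_galg G a \in group_ring k G)%MS.
Proof. by apply/envelop_mxP; exists a. Qed.

Lemma mx_of_galgD G a b :
  mx_of_galg G (a + b) = mx_of_galg G a + mx_of_galg G b.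
Proof. by rewrite -big_split; apply: eq_bigr => g; rewrite ffunE scalerDl. Qed.

Lemma mx_of_galg0 G : mx_of_galg G 0 = 0.
Proof. by apply: big1 => g _; rewrite ffunE scale0r. Qed.

Lemma mx_of_galg_eq0 G a : supported G a -> (mx_of_galg G a == 0) = (a == 0).
Proof.
move=> Ga; apply/eqP/eqP=> [E | ->]; last exact: mx_of_galg0.
rewrite -(mx_of_galgK Ga) E -(mx_of_galg0 G) mx_of_galgK //.
by move=> h _; apply: ffunE.
Qed.

Lemma mx_of_galg_inj G a b : supported G a -> supported G b ->
  mx_of_galg G a = mx_of_galg G b -> a = b.
Proof. by move=> Ga Gb E; rewrite -(mx_of_galgK Ga) E mx_of_galgK. Qed.

Lemma mx_of_galgM G a b : supported G a -> supported G b ->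
  mx_of_galg G (a * b) = mx_of_galg G a *m mx_of_galg G b.
Proof.
move=> Ga Gb; rewrite /mx_of_galg mulmx_suml.
transitivity (\sum_(g in G) \sum_(h in G)
    (a h * b (h^-1 * g)%g : k) *: regular_repr k G g).
  apply: eq_bigr => g gG; rewrite -scaler_suml galgM; congr (_ *: _).
  rewrite (bigID (mem G)) /= [X in _ + X]big1 ?addr0 // => h nh.
  by rewrite Ga ?mul0r.
rewrite exchange_big; apply: eq_bigr => h hG.
rewrite mulmx_sumr (reindex_inj (mulgI h)) /=; apply: eq_big => [x | x xG].
  exact: groupMl.
rewrite groupMl // in xG.
by rewrite mulKg repr_mxM // -scalemxAr -scalemxAl scalerA mulrC.
Qed.

(** Commuting with the translation by g means invariance of the coefficients
    under conjugation by g. *)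
Lemma mx_centerP G (m : 'M[k]_#|G|) :
  (m \in 'Z(group_ring k G))%MS <->
    in_center G (galg_of_mx m) /\ (m \in group_ring k G)%MS.
Proof.
rewrite sub_capmx; split=> [/andP[Rm /cent_mxP cm] | [[sm cm] Rm]].
  split=> //; split=> [|g h gG]; first exact: supported_galg_of_mx.
  have sg : supported G (gdelta k g).
    by move=> x nx; rewrite ffunE; case: eqP nx => // ->; rewrite gG.
  have sm := supported_galg_of_mx m.
  have := cm _ (mx_of_galg_ring G (gdelta k g)).
  rewrite -{1 2}(galg_of_mxK Rm) -!mx_of_galgM // => /mx_of_galg_inj E.
  have {E} /ffunP/(_ (h * g)%g) := E (supportedM sg sm) (supportedM sm sg).
  rewrite !galgM (bigD1 g) //= big1 => [|x /negPf ne];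
    last by rewrite [gdelta k g x]ffunE ne mul0r.
  rewrite [gdelta k g g]ffunE eqxx mul1r addr0 -conjgE => ->.
  rewrite (bigD1 h) //= mulKg big1 => [|x ne];
    first by rewrite [gdelta k g g]ffunE eqxx mulr1 addr0.
  rewrite [gdelta k g _]ffunE [_ == g](_ : _ = false) ?mulr0 //.
  apply: contraNF ne => /eqP E; rewrite -(inj_eq (mulIg g)) -{1}E mulKVg //.
rewrite Rm; apply/cent_mxP=> B /galg_of_mxK <-.
rewrite -(galg_of_mxK Rm) -!mx_of_galgM //; try exact: supported_galg_of_mx.
by rewrite (class_fun_comm cm) //; apply: supported_galg_of_mx.
Qed.

Lemma mx_of_galg_center G a : in_center G a ->
  (mx_of_galg G a \in 'Z(group_ring k G))%MS.
Proof.
move=> Ha; apply/mx_centerP; rewrite mx_of_galgK; last by case: Ha.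
by split=> //; apply: mx_of_galg_ring.
Qed.

Lemma galg_of_block G (m : 'M[k]_#|G|) : is_block G m ->
  block_idem G (galg_of_mx m).
Proof.
case=> /mx_centerP[Hm Rm] mm nzm prim; have [sm _] := Hm.
split=> //.
- apply: (@mx_of_galg_inj G) => //; first exact: supportedM.
  by rewrite mx_of_galgM // galg_of_mxK.
- by rewrite -(mx_of_galg_eq0 sm) galg_of_mxK.
move=> f1 f2 Hf1 Hf2 ff1 ff2 f12 Dm; have [[s1 _] [s2 _]] := (Hf1, Hf2).
have [||||||E|E] := prim (mx_of_galg G f1) (mx_of_galg G f2);
  rewrite -?mx_of_galgM ?ff1 ?ff2 //.
- exact: mx_of_galg_center.
- exact: mx_of_galg_center.
- by rewrite f12 mx_of_galg0.
- by rewrite -mx_of_galgD -Dm galg_of_mxK.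
- by left; apply/eqP; rewrite -(mx_of_galg_eq0 s1) E.
by right; apply/eqP; rewrite -(mx_of_galg_eq0 s2) E.
Qed.

Lemma block_of_galg G f : block_idem G f -> is_block G (mx_of_galg G f).
Proof.
move=> [Hf ff nzf prim]; have [sf _] := Hf; split.
- exact: mx_of_galg_center.
- by rewrite -mx_of_galgM // ff.
- by rewrite mx_of_galg_eq0.
move=> m1 m2 /mx_centerP[H1 R1] /mx_centerP[H2 R2] mm1 mm2 m12 Df.
have [[s1 _] [s2 _]] := (H1, H2).
have to_mx a b : supported G a -> supported G b ->
  mx_of_galg G a = mx_of_galg G b -> a = b.
  exact: mx_of_galg_inj.
have [||||E|E] := prim _ _ H1 H2.
- apply: to_mx => //; first exact: supportedM.
  by rewrite mx_of_galgM // galg_of_mxK.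
- apply: to_mx => //; first exact: supportedM.
  by rewrite mx_of_galgM // galg_of_mxK.
- apply/eqP; rewrite -(mx_of_galg_eq0 (supportedM s1 s2)) mx_of_galgM //.
  by rewrite !galg_of_mxK // m12.
- have sD : supported G (galg_of_mx m1 + galg_of_mx m2).
    by case: (in_centerD H1 H2).
  by apply: to_mx => //; rewrite mx_of_galgD !galg_of_mxK.
- by left; rewrite -(galg_of_mxK R1) E mx_of_galg0.
by right; rewrite -(galg_of_mxK R2) E mx_of_galg0.
Qed.

Lemma supported_trunc G P a : supported G a ->
  supported 'C_G(P) (trunc 'C(P) a).
Proof.
move=> sa h; rewrite inE negb_and ffunE => /orP[/sa-> | /negPf-> //].
by rewrite if_same.
Qed.

Lemma brauer_trunc G P (m : 'M[k]_#|G|) :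
  brauer P m = mx_of_galg 'C_G(P) (trunc 'C(P) (galg_of_mx m)).
Proof. by apply: eq_bigr => g /setIP[gG gP]; rewrite !ffunE gP gG. Qed.

Lemma defect_group_galg (p : nat) G (m : 'M[k]_#|G|) D :
  defect_group p G m D <-> is_defect p G (galg_of_mx m) D.
Proof.
have E Q : (brauer Q m != 0) = (trunc 'C(Q) (galg_of_mx m) != 0).
  rewrite brauer_trunc mx_of_galg_eq0 //.
  exact/supported_trunc/supported_galg_of_mx.
by split=> /maxgroupP[DP max]; apply/maxgroupP; rewrite E in DP *;
  split=> // Q QP; apply: max; rewrite E in QP *.
Qed.

End Matrices.

Theorem corollary2 (k : closedFieldType) (char_k : 2%N \in [pchar k])
    (gT : finGroupType) (G : {group gT}) (e : 'M[k]_#|G|)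
    (block_e : is_block G e)
    (all_major : forall (x : gT) (eb : 'M[k]_#|'C_G(<[x]>)|),
       subsection 2 G e x eb -> major 2 G e x eb)
    (D : {group gT}) (defD : defect_group 2 G e D) :
  abelian D.
Proof.
have pre := galg_of_block block_e.
apply: (defect_abelian char_k pre) (iffLR (defect_group_galg 2 e D) defD).
move=> x f xG x2 prf nz R defR; have [[sf _] _ _ _] := prf.
apply: (iffLR (defect_group_galg 2 e R)).
apply: (all_major x (mx_of_galg 'C_G(<[x]>) f)); last first.
  by apply: (iffRL (defect_group_galg 2 _ R)); rewrite mx_of_galgK.
split=> //; first exact: block_of_galg.
have sc : supported 'C_G(<[x]>) (trunc 'C(<[x]>) (galg_of_mx e)).
  exact/supported_trunc/supported_galg_of_mx.
by rewrite brauer_trunc -mx_of_galgM // mx_of_galg_eq0 //; apply: supportedM.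
Qed.
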